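(* For each fixed integer $t\ge 2$, $\mathrm{Ex}(S_0^{(t)},n)\ge n2^{(1-o(1))\sqrt{\log t\,\log n}}$ as $n\to\infty$, where $S_0^{(t)}$ is the $3\times 2t$ 0--1 matrix with rows indexed $0,1,2$ and columns indexed $0,1,\dots,2t-1$ in which row $0$ has 1s exactly in the even-indexed columns $0,2,4,\dots,2t-2$, row $1$ has 1s exactly in columns $0$ and $2t-1$, and row $2$ has 1s exactly in the odd-indexed columns $1,3,\dots,2t-3,2t-1$.
   Context: A pattern is a 0--1 matrix. A 0--1 matrix $A$ contains a pattern $P$ if $A$ can be transformed into $P$ by removing rows and columns from $A$ (keeping the order of the remaining ones) and changing some 1s to 0s; otherwise $A$ is $P$-free. $\mathrm{Ex}(P,n)$ is the maximum number of 1s in an $n\times n$ 0--1 matrix that is $P$-free. $\log$ is the binary logarithm. *)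

(* Defs.v *)
From mathcomp Require Import all_boot all_order all_algebra.
From mathcomp Require Import all_classical all_reals all_analysis.

Set Implicit Arguments.
Unset Strict Implicit.
Unset Printing Implicit Defensive.

Import Order.TTheory GRing.Theory Num.Theory.

Local Open Scope ring_scope.

Definition strictly_increasing (k m : nat) (f : {ffun 'I_k -> 'I_m}) : bool :=
  [forall i : 'I_k, forall j : 'I_k, (i < j)%N ==> (f i < f j)%N].

(* The rows and columns that are kept are the images of f and g. *)
Definition contains (m n k l : nat) (A : 'M[bool]_(m, n))
    (P : 'M[bool]_(k, l)) : bool :=
  [exists f : {ffun 'I_k -> 'I_m}, exists g : {ffun 'I_l -> 'I_n},
    [&& strictly_increasing f, strictly_increasing g &
        [forall i, forall j, P i j ==> mxsub f g A i j]]].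

Definition ones (m n : nat) (A : 'M[bool]_(m, n)) : nat :=
  (\sum_(i < m) \sum_(j < n) A i j)%N.

Definition Ex (k l : nat) (P : 'M[bool]_(k, l)) (n : nat) : nat :=
  (\max_(A : 'M[bool]_(n, n) | ~~ contains A P) ones A)%N.

Definition S0 (t : nat) : 'M[bool]_(3, 2 * t) :=
  \matrix_(i < 3, j < (2 * t)%N)
    match val i with
    | 0%N => ~~ odd j
    | 1%N => (val j == 0%N) || (val j == (2 * t).-1%N)
    | _ => odd j
    end.

Definition log2 (R : realType) (x : R) : R := ln x / ln 2.

(* Main.v *)
(* Rows are pairs (x, R) of a slope x and a vector R in [B]^m, ordered by slope;
   columns are sequences of pairs (s_j, y_j) in [t] x [B], j < m, ordered
   lexicographically.  There is a 1 where y + x s = R in every coordinate.  In a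
   copy of S0 the three rows have slopes x0 < x1 < x2, since a slope and a column
   determine R.  At the first coordinate where columns 0 and 2t-1 differ, the
   points (s_j, y_j) lie on three lines, and either lines 0 and 2 share a point
   between the intersections of line 1 with them, so that
   a x0 + b x2 = (a + b) x1 with a + b < t, or the values of s_j on the even
   columns exhaust [t], which contradicts the order of the slopes.  The former
   is excluded by taking t^m slopes from a Behrend-type set in [t^(m(1+o(1)))].
   Then n = (t B)^m with B = t^(m(1+o(1))), and each row has about t^m ones. *)
Require Import Defs.
From mathcomp Require Import all_boot all_order all_algebra.
From mathcomp Require Import all_classical all_reals all_analysis.
From mathcomp Require Import ring lra zify.

Import Order.TTheory GRing.Theory Num.Theory.
Import numFieldNormedType.Exports.

(** * Points and lines in a single coordinate *)

(* A column digit c < t * B encodes the pair (s, y) = (c %/ B, c %% B). *)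
Definition meets (B x r c : nat) : bool := c %% B + x * (c %/ B) == r.

(** Monotonicity of [c] is only weak, because distinct columns may agree in one coordinate. *)
Lemma meets_sparse_slopes (t B x0 x1 x2 r0 r1 r2 : nat) (c : nat -> nat) :
    (forall i j, i <= j -> j < 2 * t -> c i <= c j) ->
    c 0 < c (2 * t).-1 -> c (2 * t).-1 < t * B ->
    x0 < x1 -> x1 < x2 ->
    (forall a b, 0 < a -> 0 < b -> a + b < t ->
      a * x0 + b * x2 <> (a + b) * x1) ->
    (forall i, i < t -> meets B x0 r0 (c (2 * i))) ->
    meets B x1 r1 (c 0) -> meets B x1 r1 (c (2 * t).-1) ->
    (forall i, i < t -> meets B x2 r2 (c (2 * i).+1)) ->
  False.
Proof.
move=> c_le c_lt c_bnd x01 x12 sparse m0 /eqP m1 /eqP m1' m2.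
have B_gt0 : 0 < B by case: B c_bnd {m0 m1 m1' m2}; rewrite ?muln0.
pose s i := c i %/ B; pose y i := c i %% B.
have cE i : c i = s i * B + y i by exact: divn_eq.
have t_gt0 : 0 < t by case: t c_bnd {m0 m1' m2 sparse c_le c_lt}; rewrite ?mul0n.
have s_le i j : i <= j -> j < 2 * t -> s i <= s j.
  by move=> ij jt; apply: leq_div2r; exact: c_le.
have s_lt : s (2 * t).-1 < t by rewrite ltn_divLR.
have {}m0 i : i < t -> y (2 * i) + x0 * s (2 * i) = r0 by move=> /m0/eqP.
have {}m2 i : i < t -> y (2 * i).+1 + x2 * s (2 * i).+1 = r2 by move=> /m2/eqP.
have s0_lt : s 0 < s (2 * t).-1.
  have := s_le 0 (2 * t).-1 isT ltac:(lia).
  rewrite leq_eqVlt => /predU1P[s_eq|//].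
  have := cE 0; have := cE (2 * t).-1; rewrite -s_eq.
  move: m1 m1'; rewrite -/(s _) -/(s _) -/(y _) -/(y _) -s_eq; lia.
rewrite -/(s _) -/(y _) in m1; rewrite -/(s _) -/(y _) in m1'.
have m00 := m0 0 t_gt0; rewrite muln0 in m00.
have m2l := m2 t.-1 ltac:(lia).
rewrite (_ : (2 * t.-1).+1 = (2 * t).-1) in m2l; last by lia.
(* A common point of lines 0 and 2, at abscissa s 0 + a, yields the relation
   excluded by the sparseness of the slopes. *)
have no_common i j : i < t -> j < t -> c (2 * i) <> c (2 * j).+1.
  move=> it jt cij.
  have m0i := m0 i it; have m2j := m2 j jt.
  have sij : s (2 * j).+1 = s (2 * i) by rewrite /s cij.
  have yij : y (2 * j).+1 = y (2 * i) by rewrite /y cij.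
  have si0 := s_le 0 (2 * i) isT ltac:(lia).
  have sil := s_le (2 * i) (2 * t).-1 ltac:(lia) ltac:(lia).
  rewrite sij yij in m2j.
  have [a aE] : exists a, s (2 * i) = s 0 + a by exists (s (2 * i) - s 0); lia.
  have [b bE] : exists b, s (2 * t).-1 = s 0 + a + b.
    by exists (s (2 * t).-1 - s (2 * i)); lia.
  have eq : a * x0 + b * x2 = (a + b) * x1.
    rewrite bE in m1' m2l; rewrite aE in m0i m2j; nia.
  case: (posnP a) => [a0|a_gt0]; first by nia.
  case: (posnP b) => [b0|b_gt0]; first by nia.
  by apply: (sparse a b) eq => //; lia.
(* Otherwise s takes all t values on the even columns, so that the last two
   columns both have abscissa t.-1, where line 0 is below line 1. *)
have s_step i : i.+1 < t -> s (2 * i) < s (2 * i.+1).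
  move=> it; have := s_le (2 * i) (2 * i.+1) ltac:(lia) ltac:(lia).
  rewrite leq_eqVlt => /predU1P[s_eq|//].
  have m0i := m0 i ltac:(lia); have m0i1 := m0 i.+1 it.
  have cc : c (2 * i) = c (2 * i.+1) by rewrite !cE s_eq; nia.
  have := c_le (2 * i) (2 * i).+1 ltac:(lia) ltac:(lia).
  have := c_le (2 * i).+1 (2 * i.+1) ltac:(lia) ltac:(lia).
  have := no_common i i ltac:(lia) ltac:(lia); lia.
have s_ge i : i < t -> s 0 + i <= s (2 * i).
  elim: i => [|i IH] it; first by rewrite muln0 addn0.
  by have := s_step i it; have := IH ltac:(lia); lia.
have sl := s_ge t.-1 ltac:(lia).
have sl' := s_le (2 * t.-1) (2 * t).-1 ltac:(lia) ltac:(lia).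
have cl := c_le (2 * t.-1) (2 * t).-1 ltac:(lia) ltac:(lia).
have nc := no_common t.-1 t.-1 ltac:(lia) ltac:(lia).
rewrite (_ : (2 * t.-1).+1 = (2 * t).-1) in nc; last by lia.
have m0l := m0 t.-1 ltac:(lia).
have s00 : s 0 = 0 by lia.
have sE : s (2 * t.-1) = t.-1 by lia.
have sE' : s (2 * t).-1 = t.-1 by lia.
have := cE (2 * t.-1); have := cE (2 * t).-1.
rewrite s00 sE sE' in m00 m1 m1' m0l s0_lt *.
nia.
Qed.

(** * Incidences in [m] coordinates *)

(** Peeling off the least significant digit leaves the leading coordinates to the recursive call.
    The base case empties all columns with more than [m] digits, whereas higher digits of [r] are
    ignored. *)
Fixpoint incident (t B x m r c : nat) : bool :=
  if m is m'.+1 then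
    incident t B x m' (r %/ B) (c %/ (t * B)) &&
    meets B x (r %% B) (c %% (t * B))
  else c == 0.

Lemma incident_row_inj (t B x m r r' c : nat) : r < B ^ m -> r' < B ^ m ->
  incident t B x m r c -> incident t B x m r' c -> r = r'.
Proof.
elim: m r r' c => [|m IH] r r' c; first by rewrite expn0 !ltnS !leqn0 => /eqP-> /eqP->.
rewrite expnSr /= => r_lt r'_lt /andP[i1 /eqP m1] /andP[i2 /eqP m2].
have [B0|B_gt0] := posnP B; first by rewrite B0 muln0 in r_lt.
rewrite (divn_eq r B) (divn_eq r' B) -m1 -m2.
by rewrite (IH (r %/ B) (r' %/ B) (c %/ (t * B))) // ltn_divLR.
Qed.

(** Induction on [m] finds the first coordinate separating the two end columns. If their quotients
    agree, monotonicity makes all quotients agree, so the low digits inherit the order. *)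
Lemma incident_sparse_slopes (t B x0 x1 x2 m r0 r1 r2 : nat) (c : nat -> nat) :
    0 < t -> 0 < B ->
    (forall i j, i <= j -> j < 2 * t -> c i <= c j) ->
    c 0 < c (2 * t).-1 ->
    x0 < x1 -> x1 < x2 ->
    (forall a b, 0 < a -> 0 < b -> a + b < t ->
      a * x0 + b * x2 <> (a + b) * x1) ->
    (forall i, i < t -> incident t B x0 m r0 (c (2 * i))) ->
    incident t B x1 m r1 (c 0) -> incident t B x1 m r1 (c (2 * t).-1) ->
    (forall i, i < t -> incident t B x2 m r2 (c (2 * i).+1)) ->
  False.
Proof.
move=> t_gt0 B_gt0 c_le c_lt x01 x12 sparse.
have tB_gt0 : 0 < t * B by rewrite muln_gt0 t_gt0.
elim: m r0 r1 r2 c c_le c_lt => [|m IH] r0 r1 r2 c c_le c_lt.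
  by move=> _ _ /= /eqP cl; rewrite cl in c_lt.
move=> /= i0 /andP[i1 m1] /andP[i1' m1'] i2.
have q_le i j : i <= j -> j < 2 * t -> c i %/ (t * B) <= c j %/ (t * B).
  by move=> ij jt; apply: leq_div2r; exact: c_le.
have := q_le 0 (2 * t).-1 isT ltac:(lia).
rewrite leq_eqVlt => /predU1P[q_eq|q_lt]; last first.
  apply: (IH (r0 %/ B) (r1 %/ B) (r2 %/ B) (fun i => c i %/ (t * B))
    q_le q_lt _ i1 i1') => i it.
    by case/andP: (i0 i it).
  by case/andP: (i2 i it).
have q_const i : i < 2 * t -> c i %/ (t * B) = c 0 %/ (t * B).
  move=> it; apply/eqP; rewrite eqn_leq (q_le 0 i) // q_eq q_le //; lia.
have c_mod i : i < 2 * t -> c i = c 0 %/ (t * B) * (t * B) + c i %% (t * B).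
  by move=> it; rewrite -(q_const i it); exact: divn_eq.
apply: (@meets_sparse_slopes t B x0 x1 x2 (r0 %% B) (r1 %% B) (r2 %% B)
  (fun i => c i %% (t * B))
  _ _ _ x01 x12 sparse _ m1 m1' _).
- move=> i j ij jt; have := c_le i j ij jt.
  by have := c_mod i (leq_ltn_trans ij jt); have := c_mod j jt; lia.
- by have := c_mod 0 ltac:(lia); have := c_mod (2 * t).-1 ltac:(lia); lia.
- exact: ltn_pmod.
- by move=> i it; case/andP: (i0 i it).
- by move=> i it; case/andP: (i2 i it).
Qed.

(** * Counting incidences *)

Lemma sum_nat_divmod (n k : nat) (F : nat -> nat -> nat) : 0 < k ->
  \sum_(0 <= i < n * k) F (i %/ k) (i %% k) =
  \sum_(0 <= i < n) \sum_(0 <= j < k) F i j.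
Proof.
move=> k_gt0; rewrite big_nat_mul; apply: eq_bigr => i _.
rewrite -[i * k]add0n big_addn mulSn addnK.
apply: eq_big_nat => j /andP[_ jk].
by rewrite addnC divnMDl // modnMDl divn_small // addn0 modn_small.
Qed.

(** At each abscissa [s < t], every [y < B - z] gives a valid row [y + x * s < B], since
    [x * s <= t.-1 * x <= z]. *)
Lemma meets_count (t B x z : nat) : 0 < B -> t.-1 * x <= z ->
  (B - z) * t <= \sum_(0 <= r < B) \sum_(0 <= c < t * B) meets B x r c.
Proof.
move=> B_gt0 z_ge; rewrite exchange_big_nat /=.
rewrite (sum_nat_divmod t B (fun s y => \sum_(0 <= r < B) (y + x * s == r))) //.
rewrite mulnC -{1}[t]subn0 -sum_nat_const_nat big_nat [leqRHS]big_nat.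
apply: leq_sum => s /andP[_ st].
rewrite (@big_cat_nat _ _ _ (B - z)) ?leq_subr //=.
apply: leq_trans (leq_addr _ _).
rewrite -[leqLHS]muln1 -{1}[B - z]subn0 -sum_nat_const_nat.
rewrite big_nat [leqRHS]big_nat; apply: leq_sum => y /andP[_ yB].
have yB' : y + x * s < B by nia.
by rewrite big_mkord (bigD1 (Ordinal yB')) //= eqxx.
Qed.

(** The coordinates are independent, so the count is a product of [m] single-coordinate counts. *)
Lemma incident_count (t B x z m : nat) : 0 < t -> 0 < B -> t.-1 * x <= z ->
  ((B - z) * t) ^ m <=
  \sum_(0 <= r < B ^ m) \sum_(0 <= c < (t * B) ^ m) incident t B x m r c.
Proof.
move=> t_gt0 B_gt0 z_ge; have tB_gt0 : 0 < t * B by rewrite muln_gt0 t_gt0.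
elim: m => [|m IH]; first by rewrite !expn0 !big_nat1.
rewrite !expnSr.
rewrite (sum_nat_divmod (B ^ m) B (fun r' r => \sum_(0 <= c < (t * B) ^ m * (t * B))
  (incident t B x m r' (c %/ (t * B)) && meets B x r (c %% (t * B))))) //.
under eq_bigr => r' _.
  under eq_bigr => r _.
    rewrite (sum_nat_divmod _ _
      (fun c' c => incident t B x m r' c' && meets B x r c)) //.
    under eq_bigr => c' _ do under eq_bigr => c _ do rewrite -mulnb.
    rewrite -(big_distrlr _ _ _ xpredT xpredT) /=.
    over.
  over.
rewrite -(big_distrlr _ _ _ xpredT xpredT) /=.
by apply: leq_mul => //; exact: meets_count.
Qed.

(** * Behrend-type sets of slopes *)

(* The k lowest base-d digits of q, read in base D. *)
Fixpoint rebase (d D k q : nat) : nat :=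
  if k is k'.+1 then rebase d D k' (q %/ d) * D + q %% d else 0.

(** The squared Euclidean norm of the digit vector. *)
Fixpoint sqdigits (d k q : nat) : nat :=
  if k is k'.+1 then sqdigits d k' (q %/ d) + (q %% d) ^ 2 else 0.

Lemma rebase_lt (d D k q : nat) : 0 < d -> d <= D -> rebase d D k q < D ^ k.
Proof.
move=> d_gt0 dD; elim: k q => [|k IH] q //=.
have := IH (q %/ d); have := ltn_pmod q d_gt0; rewrite expnS; nia.
Qed.

Lemma sqdigits_le (d k q : nat) : 0 < d -> sqdigits d k q <= k * d ^ 2.
Proof.
move=> d_gt0; elim: k q => [|k IH] q //=.
have := IH (q %/ d); have := ltn_pmod q d_gt0; rewrite !expnS !expn0; nia.
Qed.

Lemma rebase_mono (d D k q q' : nat) : 0 < d -> d <= D -> q < q' ->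
  q' < d ^ k -> rebase d D k q < rebase d D k q'.
Proof.
move=> d_gt0 dD; elim: k q q' => [|k IH] q q' qq'; first by rewrite expn0; lia.
rewrite expnSr => q'_lt /=.
have := leq_div2r d (ltnW qq'); rewrite leq_eqVlt => /predU1P[eq|lt].
  by move: qq'; rewrite {1}(divn_eq q d) {1}(divn_eq q' d) eq ltn_add2l ltn_add2l.
have := IH _ _ lt; rewrite ltn_divLR // => /(_ q'_lt).
have := ltn_pmod q d_gt0; nia.
Qed.

Lemma digit_sum_inj (D h l h' l' : nat) : l < D -> l' < D ->
  h * D + l = h' * D + l' -> h = h' /\ l = l'.
Proof.
move=> lD l'D eq.
have h_eq : h = h'.
  have := congr1 (divn^~ D) eq; rewrite !divnMDl ?divn_small ?addn0 //; lia.
by split=> //; move: eq; rewrite h_eq => /addnI.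
Qed.

(** With [z = v1 - v0] and [w = v2 - v1], the gap is the weighted variance [a * z ^ 2 + b * w ^ 2],
    which vanishes only for [z = w = 0]. *)
Lemma convex_sqr (a b v0 v1 v2 : nat) : 0 < a -> 0 < b ->
    a * v0 + b * v2 = (a + b) * v1 ->
  (a + b) * v1 ^ 2 <= a * v0 ^ 2 + b * v2 ^ 2 /\
  ((a + b) * v1 ^ 2 = a * v0 ^ 2 + b * v2 ^ 2 -> v0 = v2).
Proof.
wlog v02 : a b v0 v2 / v0 <= v2 => [th|].
  have [|/ltnW] := leqP v0 v2; first exact: th.
  move=> v20 a_gt0 b_gt0; rewrite addnC => vE.
  have [] := th b a v2 v0 v20 b_gt0 a_gt0 ltac:(by rewrite vE addnC).
  rewrite (addnC b a) (addnC (b * _)) => le eq.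
  by split=> // /eq.
move=> a_gt0 b_gt0 vE; rewrite !expnS !expn0 !muln1.
have [z zE] : exists z, v1 = v0 + z by exists (v1 - v0); nia.
have [w wE] : exists w, v2 = v1 + w by exists (v2 - v1); nia.
have aw : a * z = b * w by subst; nia.
have dE : a * (v0 * v0) + b * (v2 * v2) =
    (a + b) * (v1 * v1) + (a * z * z + b * w * w).
  by rewrite wE zE; nia.
split; first by rewrite dE leq_addr.
by rewrite dE => /eqP; rewrite -{1}[X in X == _]addn0 eqn_add2l; nia.
Qed.

(** Weighted digit sums stay below [t * d], so the relation splits into digits and [convex_sqr]
    applies to each; equality of the totals forces equality at every digit. *)
Lemma sqdigits_convex (t d k a b q0 q1 q2 : nat) : 0 < d ->
    0 < a -> 0 < b -> a + b < t ->
    q0 < d ^ k -> q1 < d ^ k -> q2 < d ^ k ->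
    a * rebase d (t * d) k q0 + b * rebase d (t * d) k q2 =
      (a + b) * rebase d (t * d) k q1 ->
  (a + b) * sqdigits d k q1 <= a * sqdigits d k q0 + b * sqdigits d k q2 /\
  ((a + b) * sqdigits d k q1 = a * sqdigits d k q0 + b * sqdigits d k q2 ->
    q0 = q2).
Proof.
move=> d_gt0 a_gt0 b_gt0 abt; elim: k q0 q1 q2 => [|k IH] q0 q1 q2.
  by rewrite expn0 !ltnS !leqn0 => /eqP-> /eqP-> /eqP->; split=> //=; nia.
rewrite expnSr /= -!ltn_divLR // => q0k q1k q2k eq.
have v0_lt := ltn_pmod q0 d_gt0.
have v1_lt := ltn_pmod q1 d_gt0.
have v2_lt := ltn_pmod q2 d_gt0.
move: (divn_eq q0 d) (divn_eq q2 d) eq q0k q1k q2k v0_lt v1_lt v2_lt.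
move: (q0 %/ d) (q1 %/ d) (q2 %/ d) (q0 %% d) (q1 %% d) (q2 %% d).
move=> h0 h1 h2 v0 v1 v2 q0E q2E eq q0k q1k q2k v0_lt v1_lt v2_lt.
have [hE vE] : a * rebase d (t * d) k h0 + b * rebase d (t * d) k h2 =
      (a + b) * rebase d (t * d) k h1 /\ a * v0 + b * v2 = (a + b) * v1.
  by apply: (@digit_sum_inj (t * d)); [nia|nia|lia].
have [le1 eq1] := IH _ _ _ q0k q1k q2k hE.
have [le2 eq2] : (a + b) * v1 ^ 2 <= a * v0 ^ 2 + b * v2 ^ 2 /\
    ((a + b) * v1 ^ 2 = a * v0 ^ 2 + b * v2 ^ 2 -> v0 = v2).
  by apply: convex_sqr.
split=> [|sE]; first by lia.
have h_eq : h0 = h2 by apply: eq1; lia.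
have v_eq : v0 = v2 by apply: eq2; lia.
by rewrite q0E q2E h_eq v_eq.
Qed.

(* The digit part forces a relation a x0 + b x2 = (a + b) x1 to hold digit by
   digit (base t * d leaves no carries), and the square part then contradicts
   strict convexity; Behrend's restriction to a sphere is not needed. *)
Definition behrend (t d k q : nat) : nat :=
  rebase d (t * d) k q * (t * (k * d ^ 2).+1) + sqdigits d k q.

Lemma behrend_mono (t d k q q' : nat) : 0 < t -> 0 < d -> q < q' ->
  q' < d ^ k -> behrend t d k q < behrend t d k q'.
Proof.
move=> t_gt0 d_gt0 qq' q'_lt; rewrite /behrend.
have := @rebase_mono d (t * d) k q q' d_gt0 (leq_pmull _ t_gt0) qq' q'_lt.
have := @sqdigits_le d k q d_gt0; have := leq_pmull (k * d ^ 2).+1 t_gt0.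
nia.
Qed.

Lemma behrend_sparse (t d k a b q0 q1 q2 : nat) : 0 < d ->
    0 < a -> 0 < b -> a + b < t ->
    q0 < q2 -> q1 < d ^ k -> q2 < d ^ k ->
  a * behrend t d k q0 + b * behrend t d k q2 <> (a + b) * behrend t d k q1.
Proof.
move=> d_gt0 a_gt0 b_gt0 abt q02 q1k q2k; rewrite /behrend => eq.
have S q := @sqdigits_le d k q d_gt0.
have S0 := S q0; have S1 := S q1; have S2 := S q2.
(* Both weighted sums of [sqdigits] are at most [(a + b) * (k * d ^ 2)], below the multiplier of
   [rebase], so the two parts separate. *)
have [fE sE] : a * rebase d (t * d) k q0 + b * rebase d (t * d) k q2 =
      (a + b) * rebase d (t * d) k q1 /\
    a * sqdigits d k q0 + b * sqdigits d k q2 = (a + b) * sqdigits d k q1.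
  by apply: (@digit_sum_inj (t * (k * d ^ 2).+1)); [nia|nia|lia].
have [_ /(_ (esym sE)) q_eq] := @sqdigits_convex t d k a b q0 q1 q2 d_gt0
  a_gt0 b_gt0 abt (ltn_trans q02 q2k) q1k q2k fE.
by rewrite q_eq ltnn in q02.
Qed.

Lemma behrend_lt (t d k q : nat) : 0 < t -> 0 < d ->
  behrend t d k q < (t * d) ^ k * (t * (k * d ^ 2).+1).
Proof.
move=> t_gt0 d_gt0; rewrite /behrend.
have := @rebase_lt d (t * d) k q d_gt0 (leq_pmull _ t_gt0).
have := @sqdigits_le d k q d_gt0; have := leq_pmull (k * d ^ 2).+1 t_gt0.
nia.
Qed.

(** * The incidence matrix: freeness and number of ones *)

(* Row i encodes the slope index i %/ B ^ m < t ^ m and the base point with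
   base-B digits i %% B ^ m; rows with i >= (t * B) ^ m are zero. *)
Definition lines_mx (t B m : nat) (x : nat -> nat) (n : nat) : 'M[bool]_n :=
  (\matrix_(i < n, j < n)
    ((i < (t * B) ^ m) && incident t B (x (i %/ B ^ m)) m (i %% B ^ m) j)%N)%R.

Lemma lines_mx_S0_free (t B m : nat) (x : nat -> nat) (n : nat) :
    1 < t -> 0 < B ->
    (forall q q', q < q' -> q' < t ^ m -> x q < x q') ->
    (forall a b q0 q1 q2, 0 < a -> 0 < b -> a + b < t ->
      q0 < q2 -> q1 < t ^ m -> q2 < t ^ m ->
      a * x q0 + b * x q2 <> (a + b) * x q1) ->
  ~~ contains (lines_mx t B m x n) (S0 t).
Proof.
move=> t_gt1 B_gt0 x_mono x_sparse; apply/negP.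
case/existsP=> f /existsP[g /and3P[/forallP f_mono /forallP g_mono PA]].
have t_gt0 : 0 < t by lia.
have lines i j : S0 t i j -> f i < (t * B) ^ m /\
    incident t B (x (f i %/ B ^ m)) m (f i %% B ^ m) (g j).
  move=> Pij; have /forallP/(_ i)/forallP/(_ j) := PA.
  by rewrite Pij /= mxE /lines_mx mxE => /andP.
have f_lt (i j : 'I_3) : i < j -> f i < f j.
  by move=> ij; have /forallP/(_ j) := f_mono i; rewrite ij.
have g_le (i j : 'I_(2 * t)) : i <= j -> g i <= g j.
  rewrite leq_eqVlt => /predU1P[/val_inj->//|ij].
  by have /forallP/(_ j) := g_mono i; rewrite ij => /ltnW.
(* The default 0 is never reached: only indices below [2 * t] occur. *)
pose c k := if insub k is Some j then nat_of_ord (g j) else 0.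
have cE k (kt : k < 2 * t) : c k = g (Ordinal kt) by rewrite /c insubT.
have last_lt : (2 * t).-1 < 2 * t by lia.
have first_lt : 0 < 2 * t by lia.
pose i0 : 'I_3 := ord0; pose i1 : 'I_3 := Ordinal (isT : 1 < 3).
pose i2 : 'I_3 := Ordinal (isT : 2 < 3).
have B_exp_gt0 : 0 < B ^ m by rewrite expn_gt0 B_gt0.
have line0 k : k < t -> f i0 < (t * B) ^ m /\
    incident t B (x (f i0 %/ B ^ m)) m (f i0 %% B ^ m) (c (2 * k)).
  move=> kt; have kt2 : 2 * k < 2 * t by lia.
  by rewrite (cE _ kt2); apply: lines; rewrite mxE /= mul2n odd_double.
have line2 k : k < t -> f i2 < (t * B) ^ m /\
    incident t B (x (f i2 %/ B ^ m)) m (f i2 %% B ^ m) (c (2 * k).+1).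
  move=> kt; have kt2 : (2 * k).+1 < 2 * t by lia.
  by rewrite (cE _ kt2); apply: lines; rewrite mxE /= mul2n odd_double.
have [q1_lt line1] : f i1 < (t * B) ^ m /\
    incident t B (x (f i1 %/ B ^ m)) m (f i1 %% B ^ m) (c 0).
  by rewrite (cE _ first_lt); apply: lines; rewrite mxE.
have [_ line1'] : f i1 < (t * B) ^ m /\
    incident t B (x (f i1 %/ B ^ m)) m (f i1 %% B ^ m) (c (2 * t).-1).
  by rewrite (cE _ last_lt); apply: lines; rewrite mxE /= eqxx orbT.
have [q2_lt line2'] := line2 t.-1 ltac:(lia).
rewrite (_ : (2 * t.-1).+1 = (2 * t).-1) in line2'; last by lia.
have [_ line0'] := line0 0 t_gt0.
rewrite muln0 in line0'.
rewrite expnMn -ltn_divLR // in q1_lt; rewrite expnMn -ltn_divLR // in q2_lt.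
(* Two rows sharing a column and a slope index would have the same base point and hence coincide. *)
have q_lt (r r' c' : nat) : r < r' ->
    incident t B (x (r %/ B ^ m)) m (r %% B ^ m) c' ->
    incident t B (x (r' %/ B ^ m)) m (r' %% B ^ m) c' ->
    r %/ B ^ m < r' %/ B ^ m.
  move=> rr' ir ir'; have := leq_div2r (B ^ m) (ltnW rr').
  rewrite leq_eqVlt => /predU1P[q_eq|//].
  rewrite q_eq in ir.
  have := incident_row_inj _ _ _ _ _ _ _ _ _ ir ir'; rewrite !ltn_mod => r_eq.
  have := divn_eq r (B ^ m); rewrite q_eq r_eq // -divn_eq => r_eq'.
  by rewrite r_eq' ltnn in rr'.
have q01 := q_lt _ _ _ (f_lt i0 i1 isT) line0' line1.
have q12 := q_lt _ _ _ (f_lt i1 i2 isT) line1' line2'.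
refine (@incident_sparse_slopes t B _ _ _ m (f i0 %% B ^ m) _ (f i2 %% B ^ m) c
  t_gt0 B_gt0 _ _ (x_mono _ _ q01 q1_lt) (x_mono _ _ q12 q2_lt) _ _
  line1 line1' _).
- move=> i j ij jt; rewrite (cE _ jt) (cE _ (leq_ltn_trans ij jt)).
  exact: g_le.
- rewrite (cE _ first_lt) (cE _ last_lt).
  have /forallP/(_ (Ordinal last_lt)) := g_mono (Ordinal first_lt).
  rewrite /= (_ : 0 < (2 * t).-1) // -subn1 subn_gt0.
  exact: leq_trans (leq_pmulr 2 t_gt0).
- move=> a b a_gt0 b_gt0 abt.
  by apply: x_sparse => //; exact: ltn_trans q01 q12.
- by move=> i /line0[].
- by move=> i /line2[].
Qed.

Lemma lines_mx_ones (t B m : nat) (x : nat -> nat) (n z : nat) :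
    0 < t -> 0 < B -> (t * B) ^ m <= n ->
    (forall q, q < t ^ m -> t.-1 * x q <= z) ->
  t ^ m * ((B - z) * t) ^ m <= ones (lines_mx t B m x n).
Proof.
move=> t_gt0 B_gt0 n_ge z_ge; rewrite /ones.
pose F i j : nat :=
  (i < (t * B) ^ m) && incident t B (x (i %/ B ^ m)) m (i %% B ^ m) j.
have -> : \sum_(i < n) \sum_(j < n) lines_mx t B m x n i j =
    \sum_(0 <= i < n) \sum_(0 <= j < n) F i j.
  rewrite big_mkord; apply: eq_bigr => i _; rewrite big_mkord.
  by apply: eq_bigr => j _; rewrite mxE.
rewrite (@big_cat_nat _ _ _ ((t * B) ^ m)) //=.
apply: leq_trans (leq_addr _ _).
pose G q r := \sum_(0 <= c < (t * B) ^ m) incident t B (x q) m r c.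
apply: (@leq_trans (\sum_(0 <= i < (t * B) ^ m) G (i %/ B ^ m) (i %% B ^ m))).
  rewrite [X in \sum_(0 <= i < X) _]expnMn sum_nat_divmod ?expn_gt0 ?B_gt0 //.
  rewrite -{1}[t ^ m]subn0 -sum_nat_const_nat big_nat [leqRHS]big_nat.
  by apply: leq_sum => q /andP[_ qt]; apply: incident_count => //; exact: z_ge.
rewrite big_nat [leqRHS]big_nat; apply: leq_sum => i /andP[_ i_lt].
rewrite (@big_cat_nat _ _ _ ((t * B) ^ m) _ n) //=.
apply: leq_trans (leq_addr _ _).
by apply: leq_sum => c _; rewrite /F i_lt.
Qed.

(** * Choice of parameters *)

Lemma expn_sub_ge_half (b w m : nat) :
  0 < m -> 2 * m * w <= b -> b ^ m <= 2 * (b - w) ^ m.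
Proof.
move=> m_gt0 b_ge.
(* Bernoulli's inequality [(1 - w / b) ^ j >= 1 - j / (2 * m)], with denominators cleared. *)
have bernoulli j : j <= m -> b ^ j * (2 * m - j) <= 2 * m * (b - w) ^ j.
  elim: j => [|j IH] jm; first by rewrite !expn0 mul1n muln1 subn0.
  rewrite !expnSr; apply: (@leq_trans (b ^ j * (2 * m - j) * (b - w))).
    rewrite -!mulnA leq_mul2l; apply/orP; right.
    have [u uE] : exists u, 2 * m - j = u.+1 by exists (2 * m - j.+1); lia.
    rewrite (_ : 2 * m - j.+1 = u); last by lia.
    rewrite uE; have : u.+1 * w <= b by nia.
    nia.
  by rewrite mulnA leq_mul2r IH ?orbT //; lia.
have := bernoulli m (leqnn m).
rewrite (_ : 2 * m - m = m); last by lia.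
by rewrite mulnC -mulnA mulnCA leq_pmul2l.
Qed.

(** For [n] near [t ^ (p ^ 4)], the gain [t ^ (p * p)] is about [2 ^ sqrt (log t * log n)]. The
    shift by 3 pays for lower-order terms in the size of [B0]. *)
Lemma Ex_S0_ge (t p n : nat) : 1 < t -> 0 < p -> t ^ (p + 3) ^ 4 <= n ->
  n * t ^ (p * p) <= 2 * Ex (S0 t) n.
Proof.
move=> t_gt1 p_gt0 n_ge; have t_gt0 : 0 < t by lia.
pose d := t ^ p; pose m := p * p.
pose N := (t * d) ^ p * (t * (p * d ^ 2).+1).
(* [z] bounds [t.-1 * x] for all slopes [x < N]; from [B0] on, discarding [z] values per coordinate
   costs at most a factor 2 over all [m] coordinates. *)
pose z := t * N; pose B0 := 2 * m * z.+1.
have d_gt0 : 0 < d by rewrite expn_gt0 t_gt0.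
have dE : d ^ p = t ^ m by rewrite -expnM.
have m_gt0 : 0 < m by rewrite muln_gt0 p_gt0.
have p_le : p <= d by apply/ltnW/ltn_expl.
have t2 : 2 <= t ^ 1 by rewrite expn1.
have N_gt0 : 0 < N by rewrite !muln_gt0 expn_gt0 muln_gt0 t_gt0 d_gt0.
have N_le : N <= t ^ (p * p + 4 * p + 2).
  have -> : t ^ (p * p + 4 * p + 2) = (t * d) ^ p * (t * (t ^ 1 * (d * d ^ 2))).
    rewrite /d -expnS -!expnM -!expnD -expnS -expnD; congr (_ ^ _); lia.
  rewrite leq_mul2l leq_mul2l; apply/orP; right; apply/orP; right.
  have : p * d ^ 2 <= d * d ^ 2 by rewrite leq_mul2r p_le orbT.
  have : 0 < p * d ^ 2 by rewrite muln_gt0 p_gt0 expn_gt0 d_gt0.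
  move: (p * d ^ 2) (d * d ^ 2) => u v u_gt0 uv.
  by apply: (@leq_trans (2 * v)); [lia | rewrite leq_mul2r t2 orbT].
have B0_le : B0 <= t ^ (p * p + 6 * p + 5).
  have -> : t ^ (p * p + 6 * p + 5) =
      t ^ 1 * (d * d) * (t ^ 1 * (t * t ^ (p * p + 4 * p + 2))).
    rewrite /d -expnS -!expnD; congr (_ ^ _); lia.
  apply: leq_mul; first by apply: leq_mul => //; exact: leq_mul.
  have : z <= t * t ^ (p * p + 4 * p + 2) by rewrite leq_mul2l N_le orbT.
  have : 0 < z by rewrite muln_gt0 t_gt0.
  nia.
(* [n] need not have the form [(t * B) ^ m], so the largest [B] that fits is taken. *)
have exB : exists B, (t * B) ^ m <= n.
  by exists 0; rewrite muln0 exp0n.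
have B_bnd B : (t * B) ^ m <= n -> B <= n.
  apply: leq_trans; apply: leq_trans (leq_pmull B t_gt0) _.
  by rewrite -{1}[t * B]expn1; case: (t * B) => [|b]; rewrite ?exp0n // leq_pexp2l.
case: (ex_maxnP exB B_bnd) => B B_le B_max.
have B_ge : B0 <= B.
  apply: B_max; apply: leq_trans n_ge.
  apply: (@leq_trans ((t * t ^ (p * p + 6 * p + 5)) ^ m)).
    by rewrite leq_exp2r // leq_mul2l B0_le orbT.
  by rewrite -expnS -expnM leq_pexp2l // /m !expnS expn0; lia.
have B_gt0 : 0 < B by apply: leq_trans B_ge; rewrite !muln_gt0 p_gt0.
have n_lt : n <= (t * B.+1) ^ m.
  by rewrite leqNgt; apply/negP => /ltnW /B_max; rewrite ltnn.
(* Shifting both arguments by one compares [B - z] with [B.+1], the base that bounds [n] from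
   above. *)
have half := @expn_sub_ge_half B.+1 z.+1 m m_gt0 (leqW B_ge).
rewrite subSS in half.
pose x := behrend t d p.
have free : ~~ contains (lines_mx t B m x n) (S0 t).
  apply: lines_mx_S0_free => //; rewrite -dE.
    by move=> q q' qq' q'_lt; exact: behrend_mono.
  by move=> a b q0 q1 q2 *; exact: behrend_sparse.
apply: (@leq_trans (2 * ones (lines_mx t B m x n))); last first.
  rewrite leq_mul2l; apply/orP; right.
  exact: (@leq_bigmax_cond _ (fun A => ~~ contains A (S0 t)) (@ones n n) _ free).
apply: (@leq_trans (2 * (t ^ m * ((B - z) * t) ^ m))); last first.
  rewrite leq_mul2l; apply/orP; right; apply: lines_mx_ones => // q _.
  by apply: leq_mul (leq_pred t) (ltnW _); exact: behrend_lt.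
rewrite mulnC mulnCA leq_mul2l; apply/orP; right.
apply: leq_trans n_lt _.
by rewrite !expnMn mulnA mulnC leq_mul2r half orbT.
Qed.

(** * Asymptotics with real exponents *)

Local Open Scope classical_set_scope.
Local Open Scope ring_scope.

Lemma near_ln_ge (R : realType) (M : R) : \forall n \near \oo, M <= ln (n%:R : R).
Proof.
exists (Num.truncn (expR M)).+1 => //= n n_ge.
have n_gt : expR M < n%:R.
  by apply: (lt_le_trans (truncnS_gt (expR M))); rewrite ler_nat.
by rewrite -ler_expR lnK ?posrE ?(lt_trans _ n_gt) ?expR_gt0 // ltW.
Qed.

Lemma near_fourth_root_ge (R : realType) (t : nat) (M : R) : (2 <= t)%N ->
  \forall n \near \oo,
    M <= Num.sqrt (Num.sqrt (log2 (n%:R : R) / log2 t%:R)).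
Proof.
move=> t_ge2.
have t_gt1 : 1 < t%:R :> R by rewrite ltr1n.
have lnt_gt0 : 0 < ln (t%:R : R) by rewrite ln_gt0.
have ln2_gt0 : 0 < ln (2 : R) by rewrite ln_gt0 // ltr1n.
near=> n.
have ln_ge : M ^+ 4 * ln (t%:R : R) <= ln (n%:R : R) by near: n; exact: near_ln_ge.
have -> : log2 (n%:R : R) / log2 t%:R = ln n%:R / ln t%:R.
  by rewrite /log2; field; rewrite !gt_eqF.
apply: (le_trans (ler_norm M)).
rewrite -[X in X <= _]sqrtr_sqr ler_wsqrtr //.
rewrite -[X in X <= _]ger0_norm ?sqr_ge0 // -sqrtr_sqr ler_wsqrtr //.
by rewrite -exprM ler_pdivlMr.
Unshelve. all: by end_near. Qed.

(** Here [n = t ^ (y ^ 4)], so the square root is [y ^ 2 * log2 t]. Taking [p] as the floor of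
    [y - 3] gives [p + 3 <= y] and [p ^ 2 > (y - 4) ^ 2 > y ^ 2 - 8 * y + 1]. *)
Lemma Ex_S0_ge_real (R : realType) (t n : nat) : (2 <= t)%N ->
  let y : R := Num.sqrt (Num.sqrt (log2 n%:R / log2 t%:R)) in
  4 <= y ->
  n%:R * 2 `^ ((1 - 8 / y) * Num.sqrt (log2 t%:R * log2 n%:R)) <=
    (Ex (S0 t) n)%:R :> R.
Proof.
move=> t_ge2 y y_ge4.
have t_gt1 : 1 < t%:R :> R by rewrite ltr1n.
have t_gt0 : 0 < t%:R :> R by rewrite (lt_trans _ t_gt1).
have lnt_gt0 : 0 < ln (t%:R : R) by rewrite ln_gt0.
have ln2_gt0 : 0 < ln (2 : R) by rewrite ln_gt0 // ltr1n.
have y_gt0 : 0 < y by lra.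
have y2_gt0 : 0 < Num.sqrt (log2 n%:R / log2 t%:R) :> R by rewrite -sqrtr_gt0.
have y2 : y ^+ 2 = Num.sqrt (log2 n%:R / log2 t%:R) by rewrite sqr_sqrtr // ltW.
have y4 : y ^+ 4 = log2 n%:R / log2 t%:R.
  by rewrite (exprM y 2 2) y2 sqr_sqrtr // ltW // -sqrtr_gt0.
have lnnE : ln n%:R = y ^+ 4 * ln t%:R.
  by rewrite y4 /log2; field; rewrite !gt_eqF.
(* As [ln 0] is 0 by convention, [n = 0] would force [y = 0]. *)
have n_gt0 : (0 < n)%N.
  case: (posnP n) => // n0; move: lnnE; rewrite n0 ln0 // => /esym/eqP.
  by rewrite mulf_eq0 expf_eq0 /= !gt_eqF.
have sqrtE : Num.sqrt (log2 t%:R * log2 n%:R) = y ^+ 2 * log2 t%:R :> R.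
  have -> : log2 t%:R * log2 n%:R = (y ^+ 2 * log2 t%:R) ^+ 2 :> R.
    by rewrite /log2 lnnE; field; rewrite gt_eqF.
  by rewrite sqrtr_sqr ger0_norm // mulr_ge0 ?sqr_ge0 // divr_ge0 // ltW.
pose p := Num.truncn (y - 3).
have /andP[p_le p_gt] : p%:R <= y - 3 < p.+1%:R by apply: truncn_itv; lra.
have p_gt0 : (0 < p)%N by rewrite truncn_gt0; lra.
have expR_lnt k : expR (k%:R * ln t%:R) = t%:R ^+ k :> R.
  by rewrite expRM_natl lnK.
have n_ge : (t ^ (p + 3) ^ 4 <= n)%N.
  rewrite -(ler_nat R) natrX -expR_lnt -[leRHS]lnK ?posrE ?ltr0n //.
  rewrite ler_expR lnnE ler_pM2r // natrX natrD lerXn2r ?nnegrE ?addr_ge0 //.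
    exact: ltW.
  lra.
(* Weakening the factor 2 to [t] costs exactly 1 in the exponent of [t]. *)
have Ex_ge : n%:R * t%:R ^+ (p * p) <= t%:R * (Ex (S0 t) n)%:R :> R.
  rewrite -natrX -!natrM ler_nat (leq_trans (Ex_S0_ge t p n t_ge2 p_gt0 n_ge)) //.
  by rewrite leq_mul2r t_ge2 orbT.
rewrite -(ler_pM2l t_gt0); apply: le_trans Ex_ge.
rewrite mulrCA ler_wpM2l //.
rewrite /powR gt_eqF // sqrtE -expR_lnt -{1}(lnK (t_gt0 : t%:R \is Num.pos)) -expRD.
rewrite ler_expR.
have -> : (1 - 8 / y) * (y ^+ 2 * log2 t%:R) * ln 2 = (y ^+ 2 - 8 * y) * ln t%:R :> R.
  by rewrite /log2; field; rewrite !gt_eqF.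
rewrite -{1}[ln t%:R]mul1r -mulrDl ler_pM2r // natrM.
rewrite -natr1 in p_gt.
nra.
Qed.

Theorem theorem2p2 (R : realType) (t : nat) (t_ge2 : (2 <= t)%N) :
  exists o1 : nat -> R,
    o1 n @[n --> \oo] --> (0 : R) /\
    (\forall n \near \oo,
       n%:R * 2 `^ ((1 - o1 n) * Num.sqrt (log2 t%:R * log2 n%:R))
         <= (Ex (S0 t) n)%:R :> R).
Proof.
exists (fun n => 8 / Num.sqrt (Num.sqrt (log2 n%:R / log2 t%:R))); split.
  apply/cvgrPdist_le => e e_gt0; near=> n.
  have y_ge : 8 / e <= Num.sqrt (Num.sqrt (log2 n%:R / log2 t%:R)).
    by near: n; exact: near_fourth_root_ge.
  have y_gt0 := lt_le_trans (divr_gt0 (ltr0n R 8) e_gt0) y_ge.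
  rewrite /= sub0r normrN gtr0_norm ?divr_gt0 // ler_pdivrMr //.
  by rewrite mulrC -ler_pdivrMr.
near=> n; apply: Ex_S0_ge_real => //.
by near: n; exact: near_fourth_root_ge.
Unshelve. all: by end_near. Qed.
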